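(* Let $p$ be an odd prime and let $n \in \mathbb{Z}_+=\{0,1,2,\dots\}$. (I) For all $m_0,m_1,\ldots,m_n \in \mathbb{Z}_+$ with $n\sum_{i=0}^{n}m_i > \sum_{i=1}^{n} i m_i$, $$\int_{\mathbb{Z}_p} \left(\prod_{i=0}^{n} B_{i,n}^{m_i}(x)\right) d\mu_{-1}(x) = \begin{cases} 2+E_{nm_0+nm_1+\cdots+nm_n} & \text{if } \sum_{i=1}^{n} i m_i=0,\\[2mm] \displaystyle\left(\prod_{i=0}^{n}\binom{n}{i}^{m_i}\right)\sum_{j=0}^{\sum_{i=1}^n i m_i}\binom{\sum_{i=1}^n i m_i}{j}(-1)^{\sum_{i=1}^n i m_i-j}E_{n\sum_{i=0}^{n}m_i-j} & \text{if } \sum_{i=1}^{n} i m_i>0.\end{cases}$$ (II) For all $m_0,m_1,\ldots,m_n \in \mathbb{Z}_+$, $$\int_{\mathbb{Z}_p} \left(\prod_{i=0}^{n} B_{i,n}^{m_i}(x)\right) d\mu_{-1}(x) = \left(\prod_{i=0}^{n}\binom{n}{i}^{m_i}\right)\sum_{j=0}^{n\sum_{i=0}^{n}m_i-\sum_{i=1}^n i m_i}\binom{n\sum_{i=0}^{n}m_i-\sum_{i=1}^n i m_i}{j}(-1)^{j}E_{\sum_{i=1}^n i m_i+j}.$$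
   Context: For a uniformly differentiable function $f:\mathbb{Z}_p \to \mathbb{C}_p$ (in particular any polynomial), the fermionic $p$-adic invariant integral on $\mathbb{Z}_p$ is $$\int_{\mathbb{Z}_p} f(x)\, d\mu_{-1}(x) = \lim_{N\to\infty} \sum_{x=0}^{p^N-1} f(x)(-1)^x,$$ where the limit is taken in the $p$-adic topology. For $0\le i\le n$ the Bernstein polynomial is $B_{i,n}(x) = \binom{n}{i} x^i (1-x)^{n-i}$, and $B_{i,n}^{m}(x)$ denotes the $m$-th power $(B_{i,n}(x))^m$ (equal to $1$ when $m=0$). The Euler numbers $E_n\in\mathbb{Q}$ ($n\ge 0$) are defined by $\frac{2}{e^t+1} = \sum_{n=0}^{\infty} E_n \frac{t^n}{n!}$ and are regarded as elements of $\mathbb{Q}_p$. *)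

(* Defs.v *)
From HB Require Import structures.
From mathcomp Require Import all_boot all_order all_algebra.
From mathcomp Require Import generic_quotient ring_quotient.
From mathcomp Require Import all_classical all_reals all_analysis.

Set Implicit Arguments.
Unset Strict Implicit.
Unset Printing Implicit Defensive.

Import Order.TTheory GRing.Theory Num.Theory.
Import numFieldNormedType.Exports.

Local Open Scope quotient_scope.
Local Open Scope classical_set_scope.
Local Open Scope ring_scope.

(* The library's normed groups satisfy |x *+ n| = |x| *+ n, which excludes
   non-archimedean norms; hence a separate notion of absolute value. *)
Record absValue (R : realType) (K : fieldType) := AbsValue {
  absv :> K -> R;
  absv_ge0 : forall x, 0 <= absv x;
  absv_eq0 : forall x, (absv x == 0) = (x == 0);
  absvM : forall x y, absv (x * y) = absv x * absv y;
  absvD : forall x y, absv (x + y) <= absv x + absv y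
}.

Definition abs_cvg (R : realType) (K : fieldType) (v : absValue R K)
    (u : nat -> K) (l : K) : Prop :=
  (fun n => v (u n - l)) @ \oo --> (0 : R).

Section AbsValueTheory.
Variables (R : realType) (K : fieldType) (v : absValue R K).
Implicit Types x y : K.

Lemma absv0 : v 0 = 0. Proof. by apply/eqP; rewrite absv_eq0. Qed.

Lemma absv1 : v 1 = 1.
Proof.
have v1 : v 1 != 0 by rewrite absv_eq0 oner_eq0.
by apply: (mulfI v1); rewrite -absvM !mulr1.
Qed.

Lemma absvN x : v (- x) = v x.
Proof.
suff vN1 : v (-1) = 1 by rewrite -mulN1r absvM vN1 mul1r.
apply/eqP; rewrite -(@eqrXn2 _ 2) ?absv_ge0 //.
by rewrite expr1n expr2 -absvM mulrNN mulr1 absv1.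
Qed.

Lemma absvB x y : v (x - y) = v (y - x).
Proof. by rewrite -absvN opprB. Qed.

Lemma absvV x : v x^-1 = (v x)^-1.
Proof.
have [->|x0] := eqVneq x 0; first by rewrite invr0 absv0 invr0.
apply: (@mulfI _ (v x)); first by rewrite absv_eq0.
by rewrite -absvM !divff ?absv1 ?absv_eq0.
Qed.

Lemma absv_dist x y : `|v x - v y| <= v (x - y).
Proof.
have h a b : v a - v b <= v (a - b) by rewrite lerBlDr -{1}(subrK b a) absvD.
by rewrite ler_norml h andbT lerNl opprB absvB h.
Qed.

End AbsValueTheory.

(* The completion of a valued field: Cauchy sequences modulo null sequences. *)
Section Completion.
Variables (R : realType) (F : fieldType) (v : absValue R F).
Definition is_cauchy (u : nat -> F) : Prop :=
  forall e : R, 0 < e -> exists N, forall m n,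
    (N <= m)%N -> (N <= n)%N -> v (u m - u n) < e.

Definition is_null (u : nat -> F) : Prop := abs_cvg v u 0.

Lemma is_nullP (u : nat -> F) : is_null u <->
  forall e : R, 0 < e -> exists N, forall n, (N <= n)%N -> v (u n) < e.
Proof.
split=> [/cvgrPdist_lt h e /h[N _ hN]|h].
  exists N => n /hN /=; rewrite sub0r normrN subr0.
  by rewrite ger0_norm // absv_ge0.
apply/cvgrPdist_lt => e /h[N hN]; exists N => // n /= /hN.
by rewrite sub0r normrN subr0 ger0_norm // absv_ge0.
Qed.

Lemma cauchy_bounded (u : nat -> F) : is_cauchy u ->
  exists M : R, 0 < M /\ exists N, forall n, (N <= n)%N -> v (u n) < M.
Proof.
move=> /(_ 1 ltr01)[N hN]; exists (1 + v (u N)).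
split; first by rewrite ltr_wpDr ?absv_ge0.
exists N => n /hN/(_ (leqnn N)) h.
by rewrite -(subrK (u N) (u n)) (le_lt_trans (absvD _ _ _)) // ltrD2r.
Qed.

Definition cauchyS : {pred nat -> F} := fun u => `[< is_cauchy u >].

Lemma cauchyP u : reflect (is_cauchy u) (u \in cauchyS).
Proof. exact: asboolP. Qed.

Lemma cauchyS_subring : subring_closed cauchyS.
Proof.
split=> [|u w /cauchyP hu /cauchyP hw|u w /cauchyP hu /cauchyP hw].
- by apply/cauchyP => e e0; exists 0%N => *; rewrite subrr absv0.
- apply/cauchyP => e e0; have e20 : 0 < e / 2 by rewrite divr_gt0.
  have [N hN] := hu _ e20; have [N' hN'] := hw _ e20.
  exists (maxn N N') => m n; rewrite !geq_max => /andP[a b] /andP[c d].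
  have -> : (u - w) m - (u - w) n = (u m - u n) - (w m - w n).
    by rewrite /= opprD addrACA -opprD.
  rewrite (le_lt_trans (absvD _ _ _)) // absvN [e]splitr.
  by rewrite ltrD ?hN ?hN'.
- have [M [M0 [N0 hM]]] := cauchy_bounded hu.
  have [M' [M'0 [N0' hM']]] := cauchy_bounded hw.
  apply/cauchyP => e e0.
  have [N hN] := hu (e / 2 / M') ltac:(by rewrite !divr_gt0).
  have [N' hN'] := hw (e / 2 / M) ltac:(by rewrite !divr_gt0).
  exists (maxn (maxn N N') (maxn N0 N0')) => m n; rewrite !geq_max.
  move=> /andP[/andP[Nm N'm] /andP[N0m N0'm]].
  move=> /andP[/andP[Nn N'n] /andP[N0n N0'n]].
  have -> : (u * w) m - (u * w) n = u m * (w m - w n) + (u m - u n) * w n.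
    by rewrite mulrBr mulrBl addrA subrK.
  rewrite (le_lt_trans (absvD _ _ _)) // !absvM [e]splitr ltrD //.
    rewrite -[ltRHS](mulrVK (unitf_gt0 M0)) mulrC.
    by rewrite ltr_pM ?absv_ge0 ?hN' ?hM.
  rewrite -[ltRHS](mulrVK (unitf_gt0 M'0)).
  by rewrite ltr_pM ?absv_ge0 ?hN ?hM'.
Qed.

HB.instance Definition _ :=
  GRing.isSubringClosed.Build (nat -> F) cauchyS cauchyS_subring.

Record cauchySeq := CauchySeq { cseq :> nat -> F; _ : cseq \in cauchyS }.
HB.instance Definition _ := [isSub for cseq].
HB.instance Definition _ := [Choice of cauchySeq by <:].
HB.instance Definition _ := [SubChoice_isSubComNzRing of cauchySeq by <:].

Lemma cseqP (u : cauchySeq) : is_cauchy u.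
Proof. by apply/cauchyP; case: u. Qed.

Definition nullS : {pred cauchySeq} :=
  fun u : cauchySeq => `[< is_null u >].

Lemma nullSP (u : cauchySeq) : reflect (is_null u) (u \in nullS).
Proof. exact: asboolP. Qed.

Lemma nullS_ideal : idealr_closed nullS.
Proof.
split=> [||a u w /nullSP/is_nullP hu /nullSP/is_nullP hw].
- by apply/nullSP/is_nullP => e e0; exists 0%N => *; rewrite /= absv0.
- apply/nullSP => /is_nullP/(_ 1 ltr01)[N /(_ N (leqnn N))].
  by rewrite /= absv1 ltxx.
- have [M [M0 [N0 hM]]] := cauchy_bounded (cseqP a).
  apply/nullSP/is_nullP => e e0.
  have [N hN] := hu (e / 2 / M) ltac:(by rewrite !divr_gt0).
  have [N' hN'] := hw (e / 2) ltac:(by rewrite divr_gt0).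
  exists (maxn N0 (maxn N N')) => n; rewrite !geq_max => /and3P[c d f].
  rewrite (le_lt_trans (absvD _ _ _)) // absvM [e]splitr ltrD ?hN' //.
  rewrite -[ltRHS](mulrVK (unitf_gt0 M0)) mulrC.
  by rewrite ltr_pM ?absv_ge0 ?hN ?hM.
Qed.

HB.instance Definition _ := isIdealr.Build cauchySeq nullS nullS_ideal.

Definition completion : Type := {ideal_quot nullS}.

HB.instance Definition _ := GRing.ComNzRing.on completion.

Definition cpi (u : cauchySeq) : completion := \pi_{ideal_quot nullS} u.
Definition crepr (x : completion) : cauchySeq := @repr _ {ideal_quot nullS} x.

Lemma crepr_null (u : cauchySeq) : crepr (cpi u) - u \in nullS.
Proof.
by rewrite Quotient.idealrBE; apply/eqP; rewrite reprK.
Qed.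

Lemma creprK : cancel crepr cpi. Proof. exact: reprK. Qed.

Lemma cpi_eq (u w : cauchySeq) : (cpi u == cpi w) = (u - w \in nullS).
Proof. by rewrite Quotient.idealrBE. Qed.

Lemma cpiD (u w : cauchySeq) : cpi (u + w) = cpi u + cpi w.
Proof. exact: (raddfD (\pi_{ideal_quot nullS})). Qed.

Lemma cpiM (u w : cauchySeq) : cpi (u * w) = cpi u * cpi w.
Proof. exact: (rmorphM (\pi_{ideal_quot nullS})). Qed.

Lemma cpi0 : cpi 0 = 0.
Proof. exact: (raddf0 (\pi_{ideal_quot nullS})). Qed.

Lemma cpi1 : cpi 1 = 1.
Proof. exact: (rmorph1 (\pi_{ideal_quot nullS})). Qed.

Lemma cpi_null (u : cauchySeq) : (cpi u == 0) = (u \in nullS).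
Proof. by rewrite -cpi0 cpi_eq subr0. Qed.

Lemma null_or_away (u : cauchySeq) : u \notin nullS ->
  exists d : R, 0 < d /\ exists N, forall n, (N <= n)%N -> d <= v (u n).
Proof.
move=> u0; apply: contrapT => h; move/negP: u0; apply.
apply/nullSP/is_nullP => e e0; have e20 : 0 < e / 2 by rewrite divr_gt0.
have [N hN] := cseqP u e20.
have [n [Nn un]] : exists n, (N <= n)%N /\ v (u n) < e / 2.
  apply: contrapT => k; apply: h; exists (e / 2); split=> //; exists N => n Nn.
  by rewrite leNgt; apply/negP => ?; apply: k; exists n.
exists N => m Nm; rewrite -(subrK (u n) (u m)).
by rewrite (le_lt_trans (absvD _ _ _)) // [e]splitr ltrD ?hN.
Qed.

Lemma cauchy_inv (u : cauchySeq) : u \notin nullS ->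
  (fun n => (u n)^-1) \in cauchyS.
Proof.
move=> /null_or_away[d [d0 [N0 hd]]]; apply/cauchyP => e e0.
have [N hN] := cseqP u (mulr_gt0 (mulr_gt0 e0 d0) d0).
exists (maxn N0 N) => m n; rewrite !geq_max => /andP[a b] /andP[c f].
have um : 0 < v (u m) by rewrite (lt_le_trans d0) ?hd.
have un : 0 < v (u n) by rewrite (lt_le_trans d0) ?hd.
have um0 : u m != 0 by rewrite -(absv_eq0 v) gt_eqF.
have un0 : u n != 0 by rewrite -(absv_eq0 v) gt_eqF.
have -> : (u m)^-1 - (u n)^-1 = (u m)^-1 * (u n - u m) * (u n)^-1.
  by rewrite mulrBr mulrBl mulfK // mulVf // mul1r.
rewrite !absvM !absvV ltr_pdivrMr // mulrC ltr_pdivrMr //.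
rewrite (lt_le_trans (hN _ _ f b)) //.
by rewrite -!mulrA ler_pM2l // ler_pM ?hd // ltW.
Qed.

Definition cinv (x : completion) : completion :=
  cpi (insubd (0 : cauchySeq)
    (if x == 0 then 0 else fun n => (crepr x n)^-1)).

Lemma cmulVf (x : completion) : x != 0 -> cinv x * x = 1.
Proof.
move=> x0; have u0 : crepr x \notin nullS by rewrite -cpi_null creprK.
rewrite /cinv (negPf x0) -{2}[x]creprK -cpiM -cpi1; apply/eqP.
rewrite cpi_eq; apply/nullSP/is_nullP => e e0.
have [d [d0 [N hN]]] := null_or_away u0; exists N => n /hN un.
rewrite /= val_insubd cauchy_inv //=.
rewrite [X in v X](_ : _ = (crepr x n)^-1 * crepr x n - 1) // mulVf ?subrr ?absv0 //.
by rewrite -(absv_eq0 v) gt_eqF // (lt_le_trans d0).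
Qed.

Lemma cinv0 : cinv 0 = 0.
Proof.
rewrite /cinv eqxx -cpi0; congr cpi; apply: val_inj.
by rewrite /= val_insubd; case: ifP.
Qed.

HB.instance Definition _ :=
  GRing.ComNzRing_isField.Build completion cmulVf cinv0.

Lemma cauchy_abs_cvg (u : nat -> F) : is_cauchy u -> cvgn (fun n => v (u n)).
Proof.
move=> hu; apply/cauchy_cvgP/cauchy_exP => e e0.
have [N hN] := hu e e0; exists (v (u N)); exists N => // n /= Nn.
by rewrite /ball /= (le_lt_trans (absv_dist _ _ _)) ?hN.
Qed.

Definition comp_abs (x : completion) : R :=
  limn (fun n => v (crepr x n)).

Lemma cvg_comp_abs (u : cauchySeq) :
  (fun n => v (u n)) @ \oo --> comp_abs (cpi u).
Proof.
have h := cauchy_abs_cvg (cseqP (crepr (cpi u))).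
rewrite -[X in _ --> X]addr0.
have -> : (fun n => v (u n)) =
  (fun n => v (crepr (cpi u) n)) \+ (fun n => v (u n) - v (crepr (cpi u) n)).
  by apply/funext => n /=; rewrite addrC subrK.
apply: cvgD; first exact: h.
apply/cvgrPdist_lt => e e0.
have /nullSP/is_nullP/(_ _ e0)[N hN] := crepr_null u.
exists N => // n /= /hN; rewrite sub0r normrN; apply: le_lt_trans.
by rewrite (le_trans (absv_dist _ _ _)) // absvB.
Qed.

Lemma comp_abs_unique (u : cauchySeq) (l : R) :
  (fun n => v (u n)) @ \oo --> l -> comp_abs (cpi u) = l.
Proof. by apply: (@cvg_unique R (@Rhausdorff R)) => //; exact: cvg_comp_abs. Qed.

Lemma comp_abs_ge0 x : 0 <= comp_abs x.
Proof.
apply: limr_ge; first exact: cauchy_abs_cvg (cseqP _).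
by apply: nearW => n; exact: absv_ge0.
Qed.

Lemma comp_abs_eq0 x : (comp_abs x == 0) = (x == 0).
Proof.
rewrite -[x]creprK cpi_null; apply/eqP/nullSP => [h|h].
  have := @cvg_comp_abs (crepr x); rewrite h /is_null /abs_cvg.
  by under [X in _ -> X @ _ --> _]eq_fun do rewrite subr0.
apply: comp_abs_unique; move: h; rewrite /is_null /abs_cvg.
by under [X in X @ _ --> _]eq_fun do rewrite subr0.
Qed.

Lemma comp_absM x y : comp_abs (x * y) = comp_abs x * comp_abs y.
Proof.
rewrite -[x]creprK -[y]creprK -cpiM; apply: comp_abs_unique.
under eq_fun do rewrite absvM.
by apply: cvgM; exact: cvg_comp_abs.
Qed.

Lemma comp_absD x y : comp_abs (x + y) <= comp_abs x + comp_abs y.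
Proof.
rewrite -[x]creprK -[y]creprK -cpiD.
apply: ler_cvg_to (@cvg_comp_abs _) (cvgD (@cvg_comp_abs _) (@cvg_comp_abs _)) _.
by apply: nearW => n; exact: absvD.
Qed.

Definition completion_abs : absValue R completion :=
  AbsValue comp_abs_ge0 comp_abs_eq0 comp_absM comp_absD.

Lemma comp_abs_ultra :
  (forall x y, v (x + y) <= Num.max (v x) (v y)) ->
  forall x y : completion,
    comp_abs (x + y) <= Num.max (comp_abs x) (comp_abs y).
Proof.
move=> vU x y; rewrite -[x]creprK -[y]creprK -cpiD.
apply: ler_cvg_to (@cvg_comp_abs _) _ _; last first.
  by apply: nearW => n; exact: vU.
apply: (@continuous2_cvg _ _ _ _ _ _ _ _ Num.max (comp_abs (cpi (crepr x)))
  (comp_abs (cpi (crepr y)))); [exact: (@max_continuous _ R (_, _))|exact: cvg_comp_abs..].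
Qed.

Lemma cpi_subproof (q : F) : (fun=> q : F) \in cauchyS.
Proof. by apply/cauchyP => e e0; exists 0%N => *; rewrite subrr absv0. Qed.

Definition comp_inj (q : F) : completion := cpi (CauchySeq (cpi_subproof q)).

Lemma comp_inj_abs q : comp_abs (comp_inj q) = v q.
Proof. by apply: comp_abs_unique; rewrite /=; apply: cvg_cst. Qed.

Lemma comp_injB : zmod_morphism comp_inj.
Proof.
move=> q r; rewrite /comp_inj; apply/eqP.
rewrite eq_sym subr_eq -cpiD; apply/eqP/(congr1 cpi)/val_inj/funext => n /=.
by rewrite !fctE subrK.
Qed.

Lemma comp_injM : monoid_morphism comp_inj.
Proof.
split=> [|q r]; rewrite /comp_inj.
  by rewrite -[RHS]cpi1; apply: (congr1 cpi); exact: val_inj.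
by rewrite -[RHS]cpiM; apply: (congr1 cpi); exact: val_inj.
Qed.

HB.instance Definition _ :=
  GRing.isZmodMorphism.Build F completion comp_inj comp_injB.
HB.instance Definition _ :=
  GRing.isMonoidMorphism.Build F completion comp_inj comp_injM.

End Completion.

Section PadicAbs.
Variables (R : realType) (p : nat) (p_pr : prime p).

(* |a / b|_p = p ^ (v_p b - v_p a) *)
Definition padic_fun (q : rat) : R :=
  if q == 0 then 0
  else p%:R ^+ logn p `|denq q|%N / p%:R ^+ logn p `|numq q|%N.

Let p0 : p%:R != 0 :> R.
Proof. by rewrite pnatr_eq0 -lt0n prime_gt0. Qed.

Let logn_absM (a b : int) : a != 0 -> b != 0 ->
  logn p `|(a * b)%R|%N = (logn p `|a|%N + logn p `|b|%N)%N.
Proof. by move=> a0 b0; rewrite abszM lognM // absz_gt0. Qed.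

Lemma padic_funE (a b : int) : a != 0 -> b != 0 ->
  padic_fun (a%:Q / b%:Q) = p%:R ^+ logn p `|b|%N / p%:R ^+ logn p `|a|%N.
Proof.
move=> a0 b0; set q := a%:Q / b%:Q.
have a0' : a%:Q != 0 by rewrite intr_eq0.
have b0' : b%:Q != 0 by rewrite intr_eq0.
have q0 : q != 0 by rewrite mulf_neq0 ?invr_eq0.
rewrite /padic_fun (negPf q0).
have nq0 : numq q != 0 by rewrite numq_eq0.
have : a * denq q = numq q * b.
  apply: (@intr_inj rat); rewrite !intrM numqE /q.
  by rewrite mulrAC divfK.
move/(congr1 (fun z : int => logn p `|z|%N)); rewrite !logn_absM ?denq_neq0 // => e.
apply/eqP; rewrite eqr_div ?expf_neq0 //.
by rewrite -!exprD addnC e addnC.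
Qed.

Lemma padic_ge0 q : 0 <= padic_fun q.
Proof. by rewrite /padic_fun; case: ifP => // _; rewrite divr_ge0 ?exprn_ge0. Qed.

Lemma padic_eq0 q : (padic_fun q == 0) = (q == 0).
Proof.
rewrite /padic_fun; case: ifP => [_|q0]; first by rewrite eqxx.
by rewrite mulf_eq0 invr_eq0 !(negPf (expf_neq0 _ _)).
Qed.

Lemma padicM q r : padic_fun (q * r) = padic_fun q * padic_fun r.
Proof.
have [->|q0] := eqVneq q 0; first by rewrite mul0r /padic_fun eqxx mul0r.
have [->|r0] := eqVneq r 0; first by rewrite mulr0 /padic_fun eqxx mulr0.
have -> : q * r = (numq q * numq r)%:Q / (denq q * denq r)%:Q.
  by rewrite !intrM -mulf_div !divq_num_den.
rewrite padic_funE ?mulf_neq0 ?denq_neq0 ?numq_eq0 //.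
rewrite /padic_fun (negPf q0) (negPf r0) !logn_absM ?denq_neq0 ?numq_eq0 //.
by rewrite !exprD mulf_div.
Qed.

Lemma padic_ultra q r :
  padic_fun (q + r) <= Num.max (padic_fun q) (padic_fun r).
Proof.
have [->|q0] := eqVneq q 0; first by rewrite add0r le_max lexx orbT.
have [->|r0] := eqVneq r 0; first by rewrite addr0 le_max lexx.
have [->|s0] := eqVneq (q + r) 0.
  by rewrite /padic_fun eqxx le_max padic_ge0.
pose a := numq q * denq r; pose b := numq r * denq q.
pose d := denq q * denq r.
have d0 : d != 0 by rewrite mulf_neq0 ?denq_neq0.
have a0 : a != 0 by rewrite mulf_neq0 ?denq_neq0 ?numq_eq0.
have b0 : b != 0 by rewrite mulf_neq0 ?denq_neq0 ?numq_eq0.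
have dq : (denq q)%:Q != 0 by rewrite intr_eq0 denq_neq0.
have dr : (denq r)%:Q != 0 by rewrite intr_eq0 denq_neq0.
have qE : q = a%:Q / d%:Q by rewrite !intrM -mulf_div divff // mulr1 divq_num_den.
have rE : r = b%:Q / d%:Q.
  by rewrite !intrM [X in _ / X]mulrC -mulf_div divff // mulr1 divq_num_den.
have sE : q + r = (a + b)%:Q / d%:Q by rewrite intrD mulrDl -qE -rE.
have ab0 : a + b != 0.
  by apply: contraNneq s0 => ab; rewrite sE ab mul0r.
rewrite sE {1}qE {1}rE !padic_funE //.
have p1 : 1 <= p%:R :> R by rewrite ler1n prime_gt0.
suff : (minn (logn p `|a|) (logn p `|b|) <= logn p `|(a + b)%R|)%N.
  rewrite geq_min le_max => /orP[h|h]; apply/orP; [left|right];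
  by rewrite ler_pM ?invr_ge0 ?exprn_ge0 // lef_pV2 ?posrE ?exprn_gt0
    ?ltr0n ?prime_gt0 // ler_weXn2l.
rewrite -pfactor_dvdn ?absz_gt0 //.
set k := minn _ _.
suff : ((p ^ k)%:Z %| a + b)%Z by rewrite dvdzE.
by apply: rpredD; rewrite dvdzE /= pfactor_dvdn ?absz_gt0 // geq_min leqnn ?orbT.
Qed.

Lemma padicD q r : padic_fun (q + r) <= padic_fun q + padic_fun r.
Proof.
rewrite (le_trans (padic_ultra q r)) // ge_max.
by rewrite lerDl lerDr !padic_ge0.
Qed.

Definition padic_abs : absValue R rat :=
  AbsValue padic_ge0 padic_eq0 padicM padicD.

Definition Qp : Type := completion padic_abs.
HB.instance Definition _ := GRing.Field.on Qp.

Definition Qp_abs : absValue R Qp := completion_abs padic_abs.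

Lemma Qp_abs_rat (q : rat) : Qp_abs (ratr q) = padic_fun q.
Proof.
have -> : ratr q = comp_inj padic_abs q.
  by rewrite (fmorph_eq_rat (comp_inj padic_abs)).
exact: comp_inj_abs.
Qed.

Definition padicInt_pred : {pred Qp} := fun x => Qp_abs x <= 1.

Lemma padicInt_subring : subring_closed padicInt_pred.
Proof.
split=> [|x y hx hy|x y hx hy]; rewrite /padicInt_pred unfold_in.
- by rewrite absv1.
- rewrite (le_trans (@comp_abs_ultra _ _ padic_abs padic_ultra _ _)) // ge_max.
  by rewrite -[comp_abs (- y)]/(Qp_abs (- y)) absvN; apply/andP.
- by rewrite absvM mulr_ile1 ?absv_ge0.
Qed.

HB.instance Definition _ := GRing.isSubringClosed.Build Qp padicInt_pred padicInt_subring.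

Record padicInt := PadicInt { padicInt_val :> Qp; _ : padicInt_val \in padicInt_pred }.
HB.instance Definition _ := [isSub for padicInt_val].
HB.instance Definition _ := [Choice of padicInt by <:].
HB.instance Definition _ := [SubChoice_isSubComNzRing of padicInt by <:].

End PadicAbs.

(* Formal power series over a field, as coefficient sequences. *)
Section PowerSeries.
Variable F : fieldType.
Implicit Types a b : nat -> F.

Definition ps_mul a b : nat -> F :=
  fun n => \sum_(k < n.+1) a k * b (n - k)%N.

(* The first n.+1 coefficients of the inverse of a, when a 0 != 0:
   b 0 = (a 0)^-1 and b n = - (a 0)^-1 * \sum_(1 <= k <= n) a k * b (n - k). *)
Fixpoint ps_inv_seq a n : seq F :=
  if n isn't n'.+1 then [:: (a 0%N)^-1]
  else let s := ps_inv_seq a n' in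
    rcons s (- (a 0%N)^-1 * \sum_(k < n) a k.+1 * s`_(n' - k)).

Definition ps_inv a : nat -> F := fun n => (ps_inv_seq a n)`_n.

Lemma size_ps_inv_seq a n : size (ps_inv_seq a n) = n.+1.
Proof. by elim: n => //= n IHn; rewrite size_rcons IHn. Qed.

Lemma ps_inv_seqE a n k : (k <= n)%N -> (ps_inv_seq a n)`_k = ps_inv a k.
Proof.
elim: n => [|n IHn]; first by rewrite leqn0 => /eqP ->.
rewrite leq_eqVlt => /orP[/eqP -> //|kn].
by rewrite /= nth_rcons size_ps_inv_seq kn IHn.
Qed.

Lemma ps_mulV a : a 0%N != 0 -> ps_mul a (ps_inv a) =1 fun n => (n == 0%N)%:R.
Proof.
move=> a0 [|n]; rewrite /ps_mul.
  by rewrite big_ord_recl big_ord0 addr0 /ps_inv /= divff.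
rewrite big_ord_recl subn0 {1}/ps_inv /= nth_rcons size_ps_inv_seq ltnn eqxx.
rewrite mulNr mulrN mulVKf // addrC; apply/eqP; rewrite subr_eq0; apply/eqP.
by apply: eq_bigr => i _; rewrite subSS ps_inv_seqE // leq_subr.
Qed.

End PowerSeries.

(* Coefficients of e ^ t + 1. *)
Definition exp_add1 (k : nat) : rat := (k`!%:R)^-1 + (k == 0%N)%:R.

Definition euler (n : nat) : rat := n`!%:R * (2%:R * ps_inv exp_add1 n).

Lemma exp_add1_neq0 : exp_add1 0 != 0.
Proof. by rewrite /exp_add1 eqxx fact0 invr1 -(natrD _ 1 1) pnatr_eq0. Qed.

(* (e ^ t + 1) * \sum_n E_n t ^ n / n! = 2 *)
Lemma euler_gen :
  ps_mul exp_add1 (fun n => euler n / n`!%:R) =1 fun n => 2%:R * (n == 0%N)%:R.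
Proof.
move=> n; have := ps_mulV exp_add1_neq0 n; rewrite /ps_mul => <-.
rewrite big_distrr /=; apply: eq_bigr => i _.
have f0 k : k`!%:R != 0 :> rat by rewrite pnatr_eq0 -lt0n fact_gt0.
by rewrite /euler [_`!%:R * _]mulrC mulfK ?f0 // mulrCA.
Qed.

Definition bernstein (K : fieldType) (n i : nat) : {poly K} :=
  'C(n, i)%:R *: ('X^i * (1 - 'X) ^+ (n - i)).

(* K stands for any valued field receiving Q_p isometrically: C_p, or Q_p
   itself. Limits for an absolute value are unique, so is_fermionic_integral
   determines I; it also asserts that the limit exists. *)
Section FermionicIntegral.
Variables (R : realType) (p : nat) (p_pr : prime p).
Variables (K : fieldType) (w : absValue R K).

Definition fermionic_sum (f : padicInt R p_pr -> K) (N : nat) : K :=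
  \sum_(x < p ^ N) f (x%:R) * (-1) ^+ x.

Definition is_fermionic_integral (f : padicInt R p_pr -> K) (I : K) : Prop :=
  abs_cvg w (fermionic_sum f) I.

End FermionicIntegral.

(* Main.v *)
Require Import Defs.
From mathcomp Require Import all_boot all_order all_algebra.
From mathcomp Require Import all_classical all_reals all_analysis.
From mathcomp Require Import ring.

(* Every polynomial over K is g(x+1) + g(x) for some g, and since p ^ N is odd
   the alternating sum of such a polynomial telescopes to g(0) + g(p ^ N),
   which tends to 2 g(0). Applied to g = x ^ k this gives the recurrence of the
   Euler numbers, so x ^ k integrates to E_k; applied to h(x) = g(2 - x) it
   gives the reflection formula
     \int f(1 - x) = \int f(x) + 2 (f(1) - f(0)).
   The Bernstein product is a constant times x ^ S (1 - x) ^ T. Expanding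
   (1 - x) ^ T gives (II). Expanding the reflected polynomial x ^ T (1 - x) ^ S
   gives (I), where f(1) - f(0) = 1 if S = 0 and 0 if S > 0. *)

Set Implicit Arguments.
Unset Strict Implicit.
Unset Printing Implicit Defensive.

Import Order.TTheory GRing.Theory Num.Theory.
Import numFieldNormedType.Exports.

Local Open Scope ring_scope.

(** * Limits with respect to an absolute value *)

Section AbsCvg.
Local Open Scope classical_set_scope.
Local Open Scope ring_scope.
Variables (R : realType) (K : fieldType) (v : absValue R K).
Implicit Types (a b : nat -> K) (c l x : K).

Lemma absvX x n : v (x ^+ n) = v x ^+ n.
Proof. by elim: n => [|n IHn]; rewrite ?absv1 // !exprS absvM IHn. Qed.

Lemma eq_abs_cvg a b l : a =1 b -> abs_cvg v a l -> abs_cvg v b l.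
Proof. by move=> /funext ->. Qed.

Lemma abs_cvg_cst c : abs_cvg v (fun=> c) c.
Proof.
rewrite /abs_cvg; under eq_fun do rewrite subrr absv0.
exact: cvg_cst.
Qed.

Lemma abs_cvgD a b l l' :
  abs_cvg v a l -> abs_cvg v b l' -> abs_cvg v (fun n => a n + b n) (l + l').
Proof.
rewrite /abs_cvg => al bl'; apply: squeeze_cvgr (cvg_cst 0) _; last first.
  by rewrite -[X in _ --> X]addr0; exact: cvgD al bl'.
apply: nearW => n; rewrite absv_ge0 /= opprD addrACA; exact: absvD.
Qed.

Lemma abs_cvgZ c a l : abs_cvg v a l -> abs_cvg v (fun n => c * a n) (c * l).
Proof.
rewrite /abs_cvg => al; under eq_fun do rewrite -mulrBr absvM.
by rewrite -(mulr0 (v c)); apply: cvgM al; exact: cvg_cst.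
Qed.

Lemma abs_cvg_sum n (a : 'I_n -> nat -> K) (l : 'I_n -> K) :
  (forall i, abs_cvg v (a i) (l i)) ->
  abs_cvg v (fun N => \sum_(i < n) a i N) (\sum_(i < n) l i).
Proof.
elim: n a l => [|n IHn] a l al.
  rewrite big_ord0; apply: eq_abs_cvg (abs_cvg_cst 0) => N.
  by rewrite big_ord0.
rewrite big_ord_recl.
apply: (@eq_abs_cvg (fun N => a ord0 N + \sum_(i < n) a (lift ord0 i) N)).
  by move=> N; rewrite big_ord_recl.
by apply: abs_cvgD => //; apply: IHn.
Qed.

Lemma abs_cvg_unique a l l' : abs_cvg v a l -> abs_cvg v a l' -> l = l'.
Proof.
move=> al /(abs_cvgZ (-1)) al'; have := abs_cvgD al al'.
rewrite /abs_cvg; under eq_fun do rewrite mulN1r subrr sub0r absvN mulN1r.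
move=> h; have : v (l - l') = 0.
  by apply: (@cvg_unique R (@Rhausdorff R)) h => //; exact: cvg_cst.
by move/eqP; rewrite absv_eq0 subr_eq0 => /eqP.
Qed.

End AbsCvg.

(** * Recurrence of the Euler numbers *)

(** This is [euler_gen] at t^k multiplied by k!: e^t contributes the binomial sum, the constant 1
    contributes E_k. *)
Lemma euler_rec k :
  \sum_(j < k.+1) 'C(k, j)%:R * euler j + euler k = 2%:R * (k == 0%N)%:R.
Proof.
have f0 j : j`!%:R != 0 :> rat by rewrite pnatr_eq0 -lt0n fact_gt0.
(* The factor k! is harmless: the right side is nonzero only for k = 0, where 0! = 1. *)
have -> : 2%:R * (k == 0%N)%:R = k`!%:R * (2%:R * (k == 0%N)%:R) :> rat.
  by case: k => [|k]; rewrite ?fact0 ?mul1r ?mulr0.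
rewrite -euler_gen /ps_mul mulr_sumr.
under [RHS]eq_bigr do rewrite /exp_add1 mulrDl mulrDr.
rewrite big_split /=; congr (_ + _); last first.
  rewrite big_ord_recl big1 => [|i _]; last by rewrite mul0r mulr0.
  by rewrite subn0 mul1r addr0 mulrC divfK.
rewrite (reindex_inj rev_ord_inj); apply: eq_bigr => i _ /=.
have ik : (i <= k)%N by rewrite -ltnS.
rewrite subSS bin_sub //.
have -> : k`!%:R = 'C(k, i)%:R * (i`!%:R * (k - i)`!%:R) :> rat.
  by rewrite -!natrM bin_fact.
by field; rewrite !f0.
Qed.

(** * Solving f = g(X + 1) + g(X) in polynomials *)

Section ForwardMean.
Variable K : fieldType.
Hypothesis two_neq0 : 2%:R != 0 :> K.
Implicit Types f g : {poly K}.

(** The top term of (X + 1)^k is a second copy of X^k, so solving for X^k costs a division by 2 and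
    leaves lower powers. This drives strong induction both for solvability and for integrating
    monomials. *)
Lemma Xn_forward_mean k :
  'X^k = 2%:R^-1 *: (('X + 1) ^+ k + 'X^k
                     - \sum_(j < k) 'C(k, j)%:R *: 'X^j) :> {poly K}.
Proof.
apply: (@scalerI _ _ 2%:R) => //; rewrite scalerA divff // scale1r.
rewrite exprDn; under eq_bigr do rewrite expr1n mulr1.
rewrite (reindex_inj rev_ord_inj) /=.
under eq_bigr => i _ do
  rewrite subSS subKn -1?ltnS // bin_sub -1?ltnS // -scaler_nat.
rewrite big_ord_recr /= binn scale1r (scaler_nat 2).
ring.
Qed.

Lemma forward_mean_surj f : exists g, f = g \Po ('X + 1) + g.
Proof.
pose P f := exists g, f = g \Po ('X + 1) + g.
have PD f1 f2 : P f1 -> P f2 -> P (f1 + f2).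
  by case=> g1 -> [g2 ->]; exists (g1 + g2); rewrite comp_polyD addrACA.
have PZ c f1 : P f1 -> P (c *: f1).
  by case=> g ->; exists (c *: g); rewrite comp_polyZ scalerDr.
have P0 : P 0 by exists 0; rewrite comp_poly0 addr0.
have PX k : P 'X^k.
  elim/ltn_ind: k => k IHk; rewrite Xn_forward_mean; apply/PZ/PD.
    by exists 'X^k; rewrite comp_Xn_poly.
  by rewrite -scaleN1r; apply/PZ; elim/big_ind: _ => // i _; apply/PZ/IHk.
by rewrite -[f]coefK poly_def; elim/big_ind: _ => // i _; apply: PZ.
Qed.

End ForwardMean.

(** * Alternating sums and Bernstein products *)

Lemma alternating_sum_telescope (K : fieldType) (F : nat -> K) M : odd M ->
  \sum_(x < M) (F x.+1 + F x) * (-1) ^+ x = F 0%N + F M.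
Proof.
move=> M_odd.
rewrite -(big_mkord xpredT (fun x => (F x.+1 + F x) * (-1) ^+ x)).
(* Each term is G(x + 1) - G(x) with G(x) = - (-1)^x F(x); for odd M, G(M) = F(M). *)
rewrite (eq_big_nat _ _ (F2 := fun x => - (-1) ^+ x.+1 * F x.+1
  - (- (-1) ^+ x * F x))); last first.
  by move=> x _; rewrite exprS; ring.
rewrite telescope_sumr // -(signr_odd _ M) M_odd; ring.
Qed.

Lemma prod_bernstein (K : fieldType) n (m : 'I_n.+1 -> nat) :
  let S := (\sum_(i < n.+1 | (1 <= i)%N) i * m i)%N in
  let T := (n * \sum_(i < n.+1) m i - S)%N in
  \prod_(i < n.+1) bernstein K n i ^+ m i =
  (\prod_(i < n.+1) 'C(n, i)%:R ^+ m i) *: ('X^S * (1 - 'X) ^+ T).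
Proof.
move=> S T.
have SE : S = (\sum_(i < n.+1) i * m i)%N.
  rewrite /S big_mkcond; apply: eq_bigr => i _.
  by case: ifP => //; case: (nat_of_ord i).
have TE : T = (\sum_(i < n.+1) (n - i) * m i)%N.
  (* The subtraction does not truncate, since i <= n termwise. *)
  rewrite /T SE big_distrr -sumnB /=; last first.
    by move=> i _; rewrite leq_mul2r -ltnS ltn_ord orbT.
  by apply: eq_bigr => i _; rewrite mulnBl.
rewrite SE TE -!prodrXr -big_split -scaler_prod; apply: eq_bigr => i _.
by rewrite /bernstein exprZn exprMn -!exprM.
Qed.

Lemma reflect_beta (K : comNzRingType) S T :
  ('X^T * (1 - 'X) ^+ S) \Po (1 - 'X) = 'X^S * (1 - 'X) ^+ T :> {poly K}.
Proof.
rewrite rmorphM !rmorphXn /= comp_polyB comp_polyX comp_polyC.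
by rewrite opprB addrCA subrr addr0 mulrC.
Qed.

(** * Fermionic integrals of polynomials *)

Section PolynomialIntegral.
Variables (R : realType) (p : nat) (p_pr : prime p).
Hypothesis p_odd : odd p.
Variables (K : fieldType) (w : absValue R K).
Variable iota : {rmorphism Qp R p_pr -> K}.
Hypothesis iota_isometry : forall x : Qp R p_pr, w (iota x) = Qp_abs R p_pr x.
Implicit Types f g : {poly K}.

Let two_neq0 : 2%:R != 0 :> K.
Proof.
rewrite -[2%:R](rmorph_nat iota) fmorph_eq0.
rewrite -[2%:R](rmorph_nat (comp_inj (padic_abs R p_pr))) fmorph_eq0.
by rewrite pnatr_eq0.
Qed.

Let ratrE (q : rat) : iota (comp_inj (padic_abs R p_pr) q) = ratr q.
Proof.
exact: (fmorph_eq_rat (iota \o comp_inj (padic_abs R p_pr))).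
Qed.

(** The isometry carries the normalisation of the p-adic absolute value to K, which makes p^N tend
    to 0 there. *)
Let w_p : w p%:R = p%:R^-1.
Proof.
rewrite -(ratr_nat K) -ratrE iota_isometry [LHS]comp_inj_abs /=.
have p0 : p%:Z != 0 by rewrite eqz_nat -lt0n prime_gt0.
rewrite -[p%:R]divr1 (padic_funE R p_pr (b := 1) p0) //= logn1 expr0 div1r.
by rewrite -[X in logn p X]expn1 pfactorK.
Qed.

Lemma abs_cvg_pX k : abs_cvg w (fun N => (p ^ N)%:R ^+ k) (0 ^+ k).
Proof.
(* For k = 0 the sequence is constantly 1, and [0 ^+ 0] is 1. *)
case: k => [|k]; first exact: abs_cvg_cst.
rewrite expr0n /abs_cvg.
have -> : (fun N => w ((p ^ N)%:R ^+ k.+1 - (k.+1 == 0%N)%:R)) =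
    GRing.exp (p%:R^-1 ^+ k.+1 : R).
  by apply/funext => N; rewrite subr0 natrX exprAC !absvX w_p.
have p1 : 1 < p%:R :> R by rewrite ltr1n prime_gt1.
apply: cvg_expr; rewrite normrX ger0_norm ?invr_ge0 ?ler0n //.
by rewrite exprn_ilt1 // ?invr_ge0 ?ler0n ?invf_lt1 // (lt_trans ltr01).
Qed.

Lemma abs_cvg_horner_pX g : abs_cvg w (fun N => g.[(p ^ N)%:R]) g.[0].
Proof.
rewrite horner_coef.
apply: (@eq_abs_cvg _ _ _
  (fun N => \sum_(i < size g) g`_i * (p ^ N)%:R ^+ i)).
  by move=> N; rewrite horner_coef.
by apply: abs_cvg_sum => i; apply/abs_cvgZ/abs_cvg_pX.
Qed.

Definition poly_integral f (I : K) : Prop :=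
  is_fermionic_integral w
    (fun x : padicInt R p_pr => f.[iota (padicInt_val x)]) I.

(** The defining sums evaluate only at natural numbers, which every ring morphism preserves, so Z_p
    and [iota] drop out. *)
Lemma poly_integralP f I :
  poly_integral f I <->
  abs_cvg w (fun N => \sum_(x < p ^ N) f.[x%:R] * (-1) ^+ x) I.
Proof.
rewrite /poly_integral /is_fermionic_integral; suff -> :
  fermionic_sum (fun x : padicInt R p_pr => f.[iota (padicInt_val x)]) =
  (fun N => \sum_(x < p ^ N) f.[x%:R] * (-1) ^+ x) by [].
apply/funext => N; apply: eq_bigr => x _; congr (_.[_] * _).
have -> : padicInt_val (x%:R : padicInt R p_pr) = x%:R.
  exact: (rmorph_nat (\val : padicInt R p_pr -> Qp R p_pr)).
exact: rmorph_nat.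
Qed.

Lemma poly_integralD f g I J :
  poly_integral f I -> poly_integral g J -> poly_integral (f + g) (I + J).
Proof.
move=> /poly_integralP fI /poly_integralP gJ; apply/poly_integralP.
apply: eq_abs_cvg (abs_cvgD fI gJ) => N.
by rewrite -big_split; apply: eq_bigr => x _; rewrite hornerD mulrDl.
Qed.

Lemma poly_integralZ c f I :
  poly_integral f I -> poly_integral (c *: f) (c * I).
Proof.
move=> /poly_integralP fI; apply/poly_integralP.
apply: eq_abs_cvg (abs_cvgZ c fI) => N.
by rewrite mulr_sumr; apply: eq_bigr => x _; rewrite hornerZ mulrA.
Qed.

Lemma poly_integral_sum n (f : 'I_n -> {poly K}) (I : 'I_n -> K) :
  (forall i, poly_integral (f i) (I i)) ->
  poly_integral (\sum_(i < n) f i) (\sum_(i < n) I i).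
Proof.
move=> fI; apply/poly_integralP.
have fI' i := (poly_integralP _ _).1 (fI i).
apply: eq_abs_cvg (abs_cvg_sum fI') => N.
rewrite exchange_big; apply: eq_bigr => x _.
by rewrite horner_sum mulr_suml.
Qed.

Lemma poly_integral_unique f I J :
  poly_integral f I -> poly_integral f J -> I = J.
Proof. exact: abs_cvg_unique. Qed.

Lemma poly_integral_forward_mean g :
  poly_integral (g \Po ('X + 1) + g) (2%:R * g.[0]).
Proof.
apply/poly_integralP; rewrite mulr_natl mulr2n.
apply: eq_abs_cvg (abs_cvgD (abs_cvg_cst _ _) (abs_cvg_horner_pX g)).
move=> N; rewrite -[g.[0]]/(g.[0%:R]).
rewrite -(alternating_sum_telescope (fun x => g.[x%:R])) ?oddX ?p_odd ?orbT //.
apply: eq_bigr => x _.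
by rewrite hornerD horner_comp hornerD hornerX hornerC -natr1.
Qed.

Lemma poly_integral_Xn k : poly_integral 'X^k (ratr (euler k)).
Proof.
elim/ltn_ind: k => k IHk; rewrite Xn_forward_mean //.
(* This is [euler_rec] solved for E_k, with [k = 0] written as X^k at 0 to match the integral of
   [Xn_forward_mean]. *)
have -> : ratr (euler k) = 2%:R^-1 * (2%:R * ('X^k).[0] +
    -1 * \sum_(j < k) 'C(k, j)%:R * ratr (euler j)) :> K.
  (* Over an arbitrary field [ratr] need not be a morphism; here it agrees with the composite of Q
     -> Q_p -> K. *)
  have [phi phiE] : exists phi : {rmorphism rat -> K}, ratr =1 phi.
    by exists (iota \o comp_inj (padic_abs R p_pr)) => q; rewrite -ratrE.
  under eq_bigr do rewrite phiE -(rmorph_nat phi) -rmorphM.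
  rewrite phiE hornerXn expr0n -(rmorph_nat phi 2) -(rmorph_nat phi (k == _)).
  rewrite -(rmorphM phi 2) -euler_rec big_ord_recr /= binn mul1r.
  by rewrite -rmorph_sum (rmorph_nat phi 2) !rmorphD; field.
apply/poly_integralZ/poly_integralD.
  by rewrite -comp_Xn_poly; exact: poly_integral_forward_mean.
rewrite -scaleN1r; apply/poly_integralZ/poly_integral_sum => j.
exact/poly_integralZ/IHk.
Qed.

Lemma poly_integral_reflect f I : poly_integral f I ->
  poly_integral (f \Po (1 - 'X)) (I + 2%:R * (f.[1] - f.[0])).
Proof.
have [g ->] := forward_mean_surj two_neq0 f => fI.
rewrite (poly_integral_unique fI (poly_integral_forward_mean g)).
(* Since h(X + 1) = g(1 - X), the polynomial f(1 - X) is h(X + 1) + h(X). *)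
pose h := g \Po (2%:P - 'X).
have -> : (g \Po ('X + 1) + g) \Po (1 - 'X) = h \Po ('X + 1) + h.
  rewrite comp_polyD /h -!comp_polyA addrC.
  congr ((g \Po _) + (g \Po _)).
    by rewrite comp_polyB comp_polyC comp_polyX polyCD; ring.
  by rewrite comp_polyD comp_polyC comp_polyX polyCD; ring.
(* Both sides are 2 g(2), because f(1) - f(0) = g(2) - g(0). *)
have -> : 2%:R * g.[0] + 2%:R * ((g \Po ('X + 1) + g).[1]
    - (g \Po ('X + 1) + g).[0]) = 2%:R * h.[0].
  rewrite /h !(hornerD, horner_comp, hornerN, hornerX, hornerC).
  by rewrite add0r subr0; ring.
exact: poly_integral_forward_mean.
Qed.

Lemma poly_integral_beta S T :
  poly_integral ('X^S * (1 - 'X) ^+ T)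
    (\sum_(j < T.+1) 'C(T, j)%:R * (-1) ^+ j * ratr (euler (S + j))).
Proof.
have -> : 'X^S * (1 - 'X) ^+ T =
    \sum_(j < T.+1) ('C(T, j)%:R * (-1) ^+ j) *: 'X^(S + j) :> {poly K}.
  rewrite exprBn mulr_sumr; apply: eq_bigr => j _.
  rewrite expr1n mulr1 mulrnAr mulrCA -exprD -scalerA scaler_nat.
  by rewrite -mul_polyC rmorphXn rmorphN1.
by apply: poly_integral_sum => j; apply/poly_integralZ/poly_integral_Xn.
Qed.

End PolynomialIntegral.

(** * Integrals of products of Bernstein polynomials *)

Theorem theorem14 (R : realType) (p : nat) (p_pr : prime p) (p_odd : odd p)
    (K : fieldType) (w : absValue R K) (iota : {rmorphism Qp R p_pr -> K})
    (iota_isometry : forall x : Qp R p_pr, w (iota x) = Qp_abs R p_pr x)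
    (n : nat) :
  (forall m : 'I_n.+1 -> nat,
     let S := (\sum_(i < n.+1 | (1 <= i)%N) i * m i)%N in
     (S < n * \sum_(i < n.+1) m i)%N ->
     is_fermionic_integral w
       (fun x : padicInt R p_pr =>
          (\prod_(i < n.+1) bernstein K n i ^+ m i).[iota (padicInt_val x)])
       (if S == 0%N then
          2%:R + ratr (euler (\sum_(i < n.+1) n * m i)%N)
        else
          (\prod_(i < n.+1) 'C(n, i)%:R ^+ m i) *
          \sum_(j < S.+1) 'C(S, j)%:R * (-1) ^+ (S - j) *
            ratr (euler (n * \sum_(i < n.+1) m i - j)%N))) /\
  (forall m : 'I_n.+1 -> nat,
     let S := (\sum_(i < n.+1 | (1 <= i)%N) i * m i)%N in
     let T := (n * \sum_(i < n.+1) m i - S)%N in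
     is_fermionic_integral w
       (fun x : padicInt R p_pr =>
          (\prod_(i < n.+1) bernstein K n i ^+ m i).[iota (padicInt_val x)])
       ((\prod_(i < n.+1) 'C(n, i)%:R ^+ m i) *
        \sum_(j < T.+1) 'C(T, j)%:R * (-1) ^+ j * ratr (euler (S + j)))).
Proof.
split=> m S => [S_lt|T]; rewrite prod_bernstein -/S; last first.
  exact/poly_integralZ/poly_integral_beta.
set T := (n * _ - S)%N.
(* Positivity of T makes X^T (1 - X)^S vanish at 0, so its reflection correction is 2 * 0^S. *)
have T_gt0 : (0 < T)%N by rewrite subn_gt0.
have := poly_integral_reflect p_odd iota_isometry
  (poly_integral_beta p_odd iota_isometry T S).
rewrite reflect_beta !hornerE expr1n subrr !expr0n (gtn_eqF T_gt0).
rewrite mul0r subr0 mul1r => /(poly_integralZ (\prod_(i < n.+1) 'C(n, i)%:R ^+ m i)).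
have TS : (n * \sum_(i < n.+1) m i)%N = (T + S)%N by rewrite subnK // ltnW.
case: eqP => [S0|_].
  (* S = 0 forces m_i = 0 for all i >= 1, and the factor at i = 0 is a power of 'C(n, 0) = 1. *)
  have -> : \prod_(i < n.+1) 'C(n, i)%:R ^+ m i = 1 :> K.
    apply: big1 => i _; have [->|i0] := posnP i; first by rewrite bin0 expr1n.
    move/eqP: S0; rewrite sum_nat_eq0 => /forall_inP/(_ i i0).
    by rewrite muln_eq0 eqn0Ngt i0 => /eqP ->; rewrite expr0.
  have <- : T = (\sum_(i < n.+1) n * m i)%N by rewrite -big_distrr /= TS S0 addn0.
  by rewrite mul1r S0 big_ord1 /= bin0 expr0 addn0 !mul1r mulr1 [ratr _ + _]addrC.
rewrite mulr0 addr0.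
suff -> : \sum_(j < S.+1) 'C(S, j)%:R * (-1) ^+ j * ratr (euler (T + j)) =
    \sum_(j < S.+1) 'C(S, j)%:R * (-1) ^+ (S - j) *
      ratr (euler (n * \sum_(i < n.+1) m i - j)) :> K by [].
(* Replacing j by S - j turns the index T + j into T + S - j, where T + S = n * sum of the m_i. *)
rewrite (reindex_inj rev_ord_inj) /=; apply: eq_bigr => j _.
have jS : (j <= S)%N by rewrite -ltnS.
by rewrite subSS bin_sub // TS addnBA.
Qed.
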